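(* For every $n \in \mathbb{N}$, there exists $\delta \in (0,\infty)$ depending only on $n$ satisfying the following property: let $X$ be a proper, geodesically complete $\mathrm{CAT}(0)$ space; if $\partial_{\mathrm{T}}X$ satisfies $d_{\mathrm{GH}}(\partial_{\mathrm{T}}X, \mathbb{S}^{n-1}) < \delta$, then $X$ is $2\sqrt{n}$-bi-Lipschitz homeomorphic to $\mathbb{R}^n$.
   Context: $\mathbb{N}$ is the set of positive integers. A metric space is proper if every closed bounded subset is compact. A geodesic metric space is geodesically complete if every geodesic can be extended to a local geodesic defined on $\mathbb{R}$. $d_{\mathrm{GH}}$ is the Gromov--Hausdorff distance between metric spaces, and $\mathbb{S}^{n-1}$ is the standard unit sphere with its angular (length) metric. Tits boundary: the ideal boundary $\partial_{\infty}X$ of a complete $\mathrm{CAT}(0)$ space $X$ is the set of classes of geodesic rays modulo being asymptotic (at bounded distance). For $p\in X$, $\xi\in\partial_\infty X$ there is a unique ray $p\xi$ from $p$ in the class $\xi$; $\angle_p(\xi,\eta)$ is the angle at $p$ between $p\xi$ and $p\eta$. The angle metric is $\angle(\xi,\eta) := \sup_{p\in X}\angle_p(\xi,\eta)$; the Tits metric $d_{\mathrm{T}}$ is the length metric induced from $\angle$ (possibly taking the value $\infty$). The Tits boundary $\partial_{\mathrm{T}}X$ is $\partial_\infty X$ with $d_{\mathrm{T}}$. For $c\ge 1$, a map $f\colon X\to Y$ of metric spaces is $c$-bi-Lipschitz if $d_Y(f(x_1),f(x_2)) \le c\, d_X(x_1,x_2)$ and $d_X(x_1,x_2) \le c\,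 d_Y(f(x_1),f(x_2))$ for all $x_1,x_2\in X$; $X$ is $c$-bi-Lipschitz homeomorphic to $Y$ if there is a $c$-bi-Lipschitz homeomorphism $X\to Y$. *)

(* Defs.v *)
From HB Require Import structures.
From mathcomp Require Import all_boot all_order all_algebra ring.
From mathcomp Require Import all_classical all_reals all_analysis.

Set Implicit Arguments.
Unset Strict Implicit.
Unset Printing Implicit Defensive.

Import Order.TTheory GRing.Theory Num.Theory.
Import numFieldNormedType.Exports.

Local Open Scope classical_set_scope.
Local Open Scope ring_scope.

(** ** Euclidean space and the unit sphere *)

(* An alias is needed because the library equips 'rV[R]_n with the sup norm. *)
Definition euclidean (R : realType) (n : nat) : Type := 'rV[R]_n.

HB.instance Definition _ (R : realType) (n : nat) :=
  GRing.Lmodule.copy (euclidean R n) 'rV[R]_n.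

Section euclidean_metric.
Context {R : realType} {n : nat}.
Implicit Types u v w : euclidean R n.

Definition dotp u v : R := \sum_(i < n) u 0 i * v 0 i.

Definition enorm u : R := Num.sqrt (dotp u u).

Let edist u v : R := enorm (u - v).

Lemma dotp_ge0 u : 0 <= dotp u u.
Proof. by apply: sumr_ge0 => i _; rewrite -expr2 sqr_ge0. Qed.

Lemma dotp_lincomb u v (a b : R) :
  dotp (a *: u + b *: v) (a *: u + b *: v) =
  a ^+ 2 * dotp u u + 2 * a * b * dotp u v + b ^+ 2 * dotp v v.
Proof.
rewrite /dotp !mulr_sumr -!big_split /=; apply: eq_bigr => i _.
by rewrite !mxE; ring.
Qed.

Lemma enorm_eq0 u : enorm u = 0 -> u = 0.
Proof.
move=> /eqP; rewrite sqrtr_eq0 => u0; apply/rowP => i; rewrite mxE.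
have /eqP : dotp u u = 0 by apply/eqP; rewrite eq_le u0 dotp_ge0.
rewrite psumr_eq0 => [|j _]; last by rewrite -expr2 sqr_ge0.
by move=> /allP/(_ i (mem_index_enum _)) /=; rewrite mulf_eq0 orbb => /eqP.
Qed.

Lemma cauchy_schwarz u v : dotp u v ^+ 2 <= dotp u u * dotp v v.
Proof.
have [v0|v0] := eqVneq (dotp v v) 0.
  have /enorm_eq0 -> : enorm v = 0 by rewrite /enorm v0 sqrtr0.
  rewrite /dotp big1 => [|i _]; last by rewrite mxE mulr0.
  by rewrite expr0n /= mulr_ge0 // dotp_ge0.
have vgt0 : 0 < dotp v v by rewrite lt_neqAle eq_sym v0 dotp_ge0.
rewrite -subr_ge0 -(pmulr_rge0 _ vgt0).
rewrite [leRHS](_ : _ = dotp (dotp v v *: u + (- dotp u v) *: v)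
                            (dotp v v *: u + (- dotp u v) *: v)) ?dotp_ge0 //.
by rewrite dotp_lincomb; ring.
Qed.

Lemma enormD u v : enorm (u + v) <= enorm u + enorm v.
Proof.
rewrite -(@ler_pXn2r _ 2) ?nnegrE ?addr_ge0 ?sqrtr_ge0 //.
rewrite sqrrD !sqr_sqrtr ?dotp_ge0 //.
have := dotp_lincomb u v 1 1; rewrite !scale1r => ->.
rewrite expr1n !mul1r !mulr1 lerD2r lerD2l.
rewrite -[leRHS]mulr_natl ler_pM2l // -sqrtrM ?dotp_ge0 //.
rewrite (le_trans (ler_norm _)) // -sqrtr_sqr.
by rewrite ler_sqrt ?mulr_ge0 ?dotp_ge0 // cauchy_schwarz.
Qed.

Let edistxx u : edist u u = 0.
Proof.
rewrite /edist subrr /enorm /dotp big1 ?sqrtr0 // => i _.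
by rewrite mxE mulr0.
Qed.

Let edist_eq0 u v : edist u v = 0 -> u = v.
Proof. by move=> /enorm_eq0/eqP; rewrite subr_eq0 => /eqP. Qed.

Let edist_sym u v : edist u v = edist v u.
Proof.
rewrite /edist /enorm /dotp; congr Num.sqrt; apply: eq_bigr => i _.
by rewrite !mxE; ring.
Qed.

Let edist_triangle v u w : edist u w <= edist u v + edist v w.
Proof. by rewrite /edist -(subrKA v) enormD. Qed.

HB.instance Definition _ := @isMetric.Build R (euclidean R n)
  edist edistxx edist_eq0 edist_sym edist_triangle.

End euclidean_metric.

(* The unit sphere of R^n, that is S^(n-1). *)
Definition sphere (R : realType) (n : nat) : Type :=
  {u : euclidean R n | enorm u = 1}.

Section metric_notions.
Context {R : realType}.

(** ** Extended metrics *)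

Definition is_emetric (T : Type) (d : T -> T -> \bar R) : Prop :=
  [/\ forall x y, (0 <= d x y)%E,
      forall x y, d x y = 0%E <-> x = y,
      forall x y, d x y = d y x &
      forall x y z, (d x z <= d x y + d y z)%E].

Definition hausdorff_dist (Z : Type) (d : Z -> Z -> \bar R) (A B : set Z) :
    \bar R :=
  ereal_inf [set r%:E | r in [set r : R | [/\ 0 < r,
    forall a, A a -> exists2 b, B b & (d a b < r%:E)%E &
    forall b, B b -> exists2 a, A a & (d a b < r%:E)%E]]].

(* Z ranges over extended metric spaces, as the spaces to be compared may have
   infinite distances. The result is +oo if exactly one of S, T is empty. *)
Definition gromov_hausdorff (S T : Type) (dS : S -> S -> \bar R)
    (dT : T -> T -> \bar R) : \bar R :=
  ereal_inf [set e : \bar R |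
    exists (Z : Type) (dZ : Z -> Z -> \bar R) (f : S -> Z) (g : T -> Z),
    [/\ is_emetric dZ,
        forall x y, dZ (f x) (f y) = dS x y,
        forall x y, dZ (g x) (g y) = dT x y &
        e = hausdorff_dist dZ (range f) (range g)]].

Definition continuous_path (T : Type) (d : T -> T -> \bar R) (c : R -> T) :
    Prop :=
  forall t, t \in `[0, 1] -> forall e : R, 0 < e ->
  exists2 r : R, 0 < r &
    forall s, s \in `[0, 1] -> `|t - s| < r -> (d (c t) (c s) < e%:E)%E.

Definition polygonal_length (T : Type) (d : T -> T -> \bar R) (c : R -> T)
    (s : seq R) : \bar R :=
  let F := c \o nth 1 (0 :: s) in
  (\sum_(0 <= k < size s) d (F k) (F k.+1))%E.

Definition path_length (T : Type) (d : T -> T -> \bar R) (c : R -> T) :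
    \bar R :=
  ereal_sup [set polygonal_length d c s | s in itv_partition 0 1].

Definition length_metric (T : Type) (d : T -> T -> \bar R) (x y : T) : \bar R :=
  ereal_inf [set path_length d c | c in
    [set c : R -> T | [/\ continuous_path d c, c 0 = x & c 1 = y]]].

(* For n >= 2 this is the angle arccos <u, v> itself. For n = 1 the two points
   of S^0 are at distance +oo, like the two points of the Tits boundary of R. *)
Definition sphere_metric (n : nat) : sphere R n -> sphere R n -> \bar R :=
  length_metric (fun u v => (acos (dotp (sval u) (sval v)))%:E).

(** ** Bi-Lipschitz homeomorphisms *)

Definition bilipschitz (X Y : metricType R) (c : R) (f : X -> Y) : Prop :=
  forall x1 x2, mdist (f x1) (f x2) <= c * mdist x1 x2 /\
                mdist x1 x2 <= c * mdist (f x1) (f x2).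

Definition homeomorphism (X Y : topologicalType) (f : X -> Y) : Prop :=
  continuous f /\
  exists g : Y -> X, [/\ continuous g, cancel f g & cancel g f].

Definition bilipschitz_homeomorphic (c : R) (X Y : metricType R) : Prop :=
  exists f : X -> Y, homeomorphism f /\ bilipschitz c f.

(** ** Geodesics and CAT(0) spaces *)

Section geodesics.
Context (X : metricType R).
Implicit Types (c g : R -> X) (x y z p : X).

Definition proper_space : Prop :=
  forall A : set X, closed A ->
  (exists M : R, forall x y, A x -> A y -> mdist x y <= M) -> compact A.

(* Only the values of c on the interval i are meaningful. *)
Definition geodesic_on (i : interval R) c : Prop :=
  forall s t, s \in i -> t \in i -> mdist (c s) (c t) = `|s - t|.

Definition local_geodesic c : Prop :=
  forall t, exists2 e : R, 0 < e & geodesic_on `]t - e, t + e[ c.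

Definition geodesically_complete : Prop :=
  forall (i : interval R) c, geodesic_on i c ->
  exists2 g, local_geodesic g & forall t, t \in i -> g t = c t.

Definition geodesic_segment x y c : Prop :=
  [/\ geodesic_on `[0, mdist x y] c, c 0 = x & c (mdist x y) = y].

(* Two points on different sides of a geodesic triangle lie on two sides with a
   common vertex, here x; points on a common side need no comparison. *)
Definition cat0 : Prop :=
  (forall x y, exists c, geodesic_segment x y c) /\
  (forall x y z c1 c2 c3,
    geodesic_segment x y c1 -> geodesic_segment x z c2 ->
    geodesic_segment y z c3 ->
    forall x' y' z' : euclidean R 2,
    mdist x' y' = mdist x y -> mdist x' z' = mdist x z ->
    mdist y' z' = mdist y z ->
    forall s t : R, s \in `[0, 1] -> t \in `[0, 1] ->
    mdist (c1 (s * mdist x y)) (c2 (t * mdist x z)) <=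
    mdist (x' + s *: (y' - x')) (x' + t *: (z' - x'))).

(** ** The Tits boundary *)

(* The angle opposite to the side c in a Euclidean triangle of sides a, b, c. *)
Definition comparison_angle (a b c : R) : R :=
  acos ((a ^+ 2 + b ^+ 2 - c ^+ 2) / (2 * a * b)).

(* The (Alexandrov) angle at c 0 = c' 0. *)
Definition geodesic_angle c c' : \bar R :=
  limf_esup (fun u : R * R => (comparison_angle (mdist (c 0) (c u.1))
                                 (mdist (c' 0) (c' u.2))
                                 (mdist (c u.1) (c' u.2)))%:E)
            (filter_prod 0^'+ 0^'+).

Definition ray c : Prop := geodesic_on `[0, +oo[ c.

Definition asymptotic c c' : Prop :=
  exists M : R, forall t, 0 <= t -> mdist (c t) (c' t) <= M.

Definition ideal_boundary : Type :=
  {xi : set (R -> X) |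
    exists2 c, ray c & xi = [set c' | ray c' /\ asymptotic c c']}.

(* On [0, +oo[, the rays c and c' below are the unique rays from p in the
   classes xi and eta. *)
Definition angle_metric (xi eta : ideal_boundary) : \bar R :=
  ereal_sup [set a | exists p c c',
    [/\ sval xi c, sval eta c', c 0 = p, c' 0 = p & a = geodesic_angle c c']].

Definition tits_metric : ideal_boundary -> ideal_boundary -> \bar R :=
  length_metric angle_metric.

End geodesics.

End metric_notions.

(* Main.v *)
Require Import Defs.
From mathcomp Require Import all_boot all_order all_algebra.
From mathcomp Require Import all_classical all_reals all_analysis.
From mathcomp Require Import ring lra.

(** The homeomorphism has Busemann functions for coordinates, and the point is
that the shape of the Tits boundary controls their slopes along every ray.

Closeness to the sphere gives a relation between ideal points and unit vectors,
total in both directions, under which Tits distances exceed spherical ones by at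
most 2 delta ([gromov_hausdorff_correspondence]). Choose ideal points related to the vectors
of the standard basis, and let F be the map to R^n whose i-th coordinate is
minus the Busemann function of the i-th of them. The claim
([busemann_map_ray]) is that along any ray c whose ideal point is related to u,
the increment F (c t) - F (c 0) differs from t u by at most t / 2.

One half of the claim is the easy direction of the first variation formula: at
every point of c the angle between c and a ray to an ideal point eta related to
v is at most their Tits distance, hence at most the angle between u and v up to
2 delta; so the Busemann function of eta has slope at most - <u, v> + 2 delta
along c ([busemann_upper]). The other half ([rel_lower]) applies the first half
backwards. By geodesic completeness c extends to a line, whose other end is
related to some vector z. The ends of a line make an angle pi at each of its
points, so that u and z are nearly opposite, and the slope backwards is at most
- <z, v> + 2 delta, which is nearly <u, v>.

Everything follows from the claim. Two points of X lie on a common line, so F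
distorts distances by a factor between 1/2 and 3/2. It is onto: if x minimises
the distance from F x to v, which is possible since F is proper, follow the ray
from x to an ideal point related to the direction of v - F x, for a time
|v - F x|; the distance to v is halved, and hence was zero. Each coordinate
having an error of the order of t sqrt delta, the claim holds once delta is
small compared with 1/n.

The CAT(0) inequality enters twice: local geodesics are geodesics
([local_geodesic_line]), so that geodesic completeness yields lines; and from
every point there is a ray to every ideal point, along which the Busemann
function decreases at unit speed ([asymptotic_ray]). *)

Import Order.TTheory GRing.Theory Num.Theory.
Local Open Scope ring_scope.

Set Implicit Arguments.
Unset Strict Implicit.
Unset Printing Implicit Defensive.
Import numFieldNormedType.Exports.
Local Open Scope classical_set_scope.

(** * Induction over the nonnegative reals *)

(** The supremum of the [t] such that [P] holds on [[0, t]] is attained by the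
second hypothesis, and would be exceeded by the third. This turns statements that are local along a geodesic into global
ones: local geodesics are geodesics, and a bound on the upper right derivative
bounds the increments. *)
Lemma real_induction (R : realType) (P : R -> Prop) :
  P 0 ->
  (forall t, 0 < t -> (forall s, 0 <= s < t -> P s) -> P t) ->
  (forall t, 0 <= t -> (forall s, 0 <= s <= t -> P s) ->
    exists2 h, 0 < h & forall s, t < s < t + h -> P s) ->
  forall t, 0 <= t -> P t.
Proof.
move=> P0 Pl Pr T T0; apply: contrapT => nPT.
pose S := [set t | 0 <= t /\ forall s, 0 <= s <= t -> P s].
have S0 : S 0.
  by split=> // s /andP[s0 s0']; rewrite (_ : s = 0) //; apply/le_anti/andP.
have ST : ubound S T.
  move=> t [t0 St]; rewrite leNgt; apply/negP => Tt.
  by apply: nPT; apply: St; rewrite T0 ltW.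
have hS : has_sup S by split; [exists 0 | exists T].
have m0 : 0 <= sup S by apply: ub_le_sup => //; exists T.
have Pm s : 0 <= s < sup S -> P s.
  move=> /andP[s0 sm].
  have [t [t0 St] st] := sup_gt (ex_intro _ 0 S0) sm.
  by apply: St; rewrite s0 ltW.
have Pm' s : 0 <= s <= sup S -> P s.
  move=> /andP[s0]; rewrite le_eqVlt => /orP[/eqP ->|sm].
    move: m0; rewrite le_eqVlt => /orP[/eqP <- //|m0].
    exact: Pl.
  by apply: Pm; rewrite s0.
have [h h0 Ph] := Pr _ m0 Pm'.
have : S (sup S + h / 2).
  split=> [|s /andP[s0 sh]]; first by lra.
  have [sm|sm] := leP s (sup S); first by apply: Pm'; rewrite s0.
  by apply: Ph; lra.
have hu : has_ubound S by exists T.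
move=> /(ub_le_sup hu); lra.
Qed.

(** * Lines in CAT(0) spaces *)

Section lines.
Context {R : realType} (X : metricType R).
Implicit Types x y z : X.

(** The right-hand side is the squared distance of the corresponding points in
the comparison triangle, by the law of cosines; in this form no triangle in the
plane has to be exhibited when the CAT(0) inequality is applied. *)
Lemma cat0_sq x y z c1 c2 (s t : R) : cat0 X ->
  geodesic_segment x y c1 -> geodesic_segment x z c2 ->
  0 <= s <= 1 -> 0 <= t <= 1 ->
  mdist (c1 (s * mdist x y)) (c2 (t * mdist x z)) ^+ 2 <=
  s ^+ 2 * mdist x y ^+ 2 + t ^+ 2 * mdist x z ^+ 2 -
  s * t * (mdist x y ^+ 2 + mdist x z ^+ 2 - mdist y z ^+ 2).
Proof.
move=> [ex C] g1 g2 s01 t01.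
have [c3 g3] := ex y z.
set a := mdist x y; set b := mdist x z; set c := mdist y z.
have a0 : 0 <= a by exact: mdist_ge0.
have b0 : 0 <= b by exact: mdist_ge0.
have c0 : 0 <= c by exact: mdist_ge0.
have ab : c <= a + b by rewrite /c (le_trans (metric_triangle _ x _)) // metric_sym.
have bc : a <= b + c by rewrite /a (le_trans (metric_triangle _ z _)) // (metric_sym z).
have ac : b <= a + c by rewrite /b (le_trans (metric_triangle _ y _)).
(* [k] is the cosine of the angle at [x] in the comparison triangle; a
   degenerate triangle leaves it undetermined. *)
have [k k1 kE] : exists2 k : R, k ^+ 2 <= 1 & 2 * a * b * k = a ^+ 2 + b ^+ 2 - c ^+ 2.
  have [a00|a00] := eqVneq a 0.
    exists 0; first by rewrite expr0n.
    have -> : c = b by lra.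
    by rewrite a00; ring.
  have [b00|b00] := eqVneq b 0.
    exists 0; first by rewrite expr0n.
    have -> : c = a by lra.
    by rewrite b00; ring.
  have a1 : 0 < a by lra.
  have b1 : 0 < b by lra.
  exists ((a ^+ 2 + b ^+ 2 - c ^+ 2) / (2 * a * b)); last by field; lra.
  rewrite expr_div_n ler_pdivrMr; last by rewrite exprn_gt0 // !mulr_gt0.
  rewrite mul1r -subr_ge0.
  have -> : (2 * a * b) ^+ 2 - (a ^+ 2 + b ^+ 2 - c ^+ 2) ^+ 2 =
    ((a + b + c) * (a + b - c)) * ((a + c - b) * (b + c - a)) by ring.
  by rewrite !mulr_ge0 //; lra.
pose vec (p q : R) : euclidean R 2 := \row_(i < 2) (if i == 0 then p else q).
pose q := Num.sqrt (1 - k ^+ 2).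
have qE : q ^+ 2 = 1 - k ^+ 2 by rewrite sqr_sqrtr // subr_ge0.
have dvec (p1 q1 p2 q2 : R) : mdist (vec p1 q1) (vec p2 q2) =
    Num.sqrt ((p1 - p2) ^+ 2 + (q1 - q2) ^+ 2).
  by rewrite /mdist /= /enorm /dotp !big_ord_recl big_ord0 !mxE /= addr0 -!expr2.
have := C x y z c1 c2 c3 g1 g2 g3 (vec 0 0) (vec a 0) (vec (b * k) (b * q)).
rewrite !dvec.
have e1 : Num.sqrt ((0 - a) ^+ 2 + (0 - 0) ^+ 2) = a.
  by rewrite subrr sub0r sqrrN expr0n addr0 sqrtr_sqr ger0_norm.
have e2 : Num.sqrt ((0 - b * k) ^+ 2 + (0 - b * q) ^+ 2) = b.
  have -> : (0 - b * k) ^+ 2 + (0 - b * q) ^+ 2 = b ^+ 2 * (k ^+ 2 + q ^+ 2) by ring.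
  by rewrite qE addrC subrK mulr1 sqrtr_sqr ger0_norm.
have e3 : Num.sqrt ((a - b * k) ^+ 2 + (0 - b * q) ^+ 2) = c.
  have -> : (a - b * k) ^+ 2 + (0 - b * q) ^+ 2 =
     a ^+ 2 + b ^+ 2 * (k ^+ 2 + q ^+ 2) - 2 * a * b * k by ring.
  rewrite qE kE addrC [k ^+ 2 + _]addrC subrK.
  have -> : - (a ^+ 2 + b ^+ 2 - c ^+ 2) + (a ^+ 2 + b ^+ 2 * 1) = c ^+ 2 by ring.
  by rewrite sqrtr_sqr ger0_norm.
move=> /(_ e1 e2 e3 s t); rewrite !in_itv /= => /(_ s01 t01).
have -> : vec 0 0 + s *: (vec a 0 - vec 0 0) = vec (s * a) 0 :> euclidean R 2.
  by apply/rowP => i; rewrite !mxE; case: ifP => _; ring.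
have -> : vec 0 0 + t *: (vec (b * k) (b * q) - vec 0 0) =
    vec (t * (b * k)) (t * (b * q)) :> euclidean R 2.
  by apply/rowP => i; rewrite !mxE; case: ifP => _; ring.
rewrite dvec => H.
rewrite -(@ler_pXn2r _ 2) ?nnegrE ?sqrtr_ge0 ?mdist_ge0 // in H.
rewrite sqr_sqrtr ?addr_ge0 ?sqr_ge0 // in H.
apply: (le_trans H).
have -> : (s * a - t * (b * k)) ^+ 2 + (0 - t * (b * q)) ^+ 2 =
  s ^+ 2 * a ^+ 2 + t ^+ 2 * b ^+ 2 * (k ^+ 2 + q ^+ 2) - s * t * (2 * a * b * k) by ring.
by rewrite kE qE [k ^+ 2 + _]addrC subrK mulr1.
Qed.

Definition geodesic_line (g : R -> X) := forall s t, mdist (g s) (g t) = `|s - t|.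

(** If [g] is a geodesic on [[a, a + t]] and near [a + t], the triangle with
vertices [g (a + s)], [g (a + t)], [g (a + r)] for [s < t < r] has two points
close to [g (a + t)], one on each of the sides that meet there, that are as far
from one another as if the two sides formed a straight segment. So the comparison angle there
is pi, and the third side is the sum of the two others. *)
Lemma local_geodesic_line (g : R -> X) :
  cat0 X -> local_geodesic g -> geodesic_line g.
Proof.
move=> C lg.
suff H a t : 0 <= t -> forall s, 0 <= s <= t -> mdist (g (a + s)) (g (a + t)) = t - s.
  move=> s t; wlog st : s t / s <= t => [W|].
    by have /orP[/W //|/W] := le_total s t; rewrite metric_sym distrC.
  have := H s (t - s) _ 0; rewrite addr0 subrKC subr0 => ->; last 2 first.
  - by rewrite subr_ge0.
  - by rewrite lexx subr_ge0.
  by rewrite ler0_norm ?opprB // subr_le0.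
move: t; apply: real_induction.
- move=> s s0; have -> : s = 0 by apply/le_anti; rewrite andbC.
  by rewrite mdistxx subrr.
- (* the property passes to limits from the left, as [g] is continuous *)
  move=> t t0 IH s /andP[s0]; rewrite le_eqVlt => /orP[/eqP ->|st].
    by rewrite mdistxx subrr.
  have [e e0 ge] := lg (a + t).
  have up r : s <= r < t -> t - e < r ->
      mdist (g (a + s)) (g (a + r)) = r - s /\ mdist (g (a + r)) (g (a + t)) = t - r.
    move=> /andP[sr rt] ter; split; first by apply: IH; lra.
    by rewrite ge ?in_itv /=; [rewrite ler0_norm|..]; lra.
  set d := mdist _ _.
  have dle : d <= t - s.
    pose r := Num.max s (t - e / 2).
    have sr : s <= r by rewrite le_max lexx.
    have er : t - e / 2 <= r by rewrite le_max lexx orbT.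
    have rt : r < t by rewrite gt_max; lra.
    have [||e1 e2] := up r; [lra|lra|].
    by have := metric_triangle (g (a + s)) (g (a + r)) (g (a + t)); rewrite e1 e2 -/d; lra.
  apply/eqP; rewrite eq_le dle /= leNgt; apply/negP => dlt.
  pose f := Num.min e (t - s - d).
  have f0 : 0 < f by rewrite lt_min; lra.
  have fe : f <= e by rewrite ge_min lexx.
  have fd : f <= t - s - d by rewrite ge_min lexx orbT.
  have d0 : 0 <= d by exact: mdist_ge0.
  have [||e1 e2] := up (t - f / 3); [lra|lra|].
  have := metric_triangle (g (a + s)) (g (a + t)) (g (a + (t - f / 3))).
  by rewrite (metric_sym (g (a + t))) e1 e2 -/d; lra.
- move=> t t0 IH.
  have [e e0 ge] := lg (a + t).
  exists e => // r /andP[tr re] s /andP[s0 sr].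
  have loc u v : t - e < u <= v -> v < t + e -> mdist (g (a + u)) (g (a + v)) = v - u.
    move=> /andP[? ?] ?.
    by rewrite ge ?in_itv /=; [rewrite ler0_norm|..]; lra.
  have [ts|st] := leP t s; first by apply: loc; lra.
  pose A := t - s; pose B := r - t.
  have dA : mdist (g (a + t)) (g (a + s)) = A.
    by rewrite metric_sym IH //; lra.
  have dB : mdist (g (a + t)) (g (a + r)) = B by rewrite loc //; lra.
  have A0 : 0 < A by rewrite /A; lra.
  have B0 : 0 < B by rewrite /B; lra.
  have g1 : geodesic_segment (g (a + t)) (g (a + s)) (fun u => g (a + (t - u))).
    split; rewrite ?subr0 // ?dA; last by rewrite /A subKr.
    move=> u v; rewrite !in_itv /= => /andP[u0 uA] /andP[v0 vA].
    rewrite /A in uA vA.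
    have [uv|uv] := leP u v.
      rewrite metric_sym IH; [|lra|lra].
      by rewrite ler0_norm; lra.
    rewrite IH; [|lra|lra].
    by rewrite gtr0_norm; lra.
  have g2 : geodesic_segment (g (a + t)) (g (a + r)) (fun u => g (a + (t + u))).
    split; rewrite ?addr0 // ?dB; last by rewrite /B subrKC.
    move=> u v; rewrite !in_itv /= => /andP[u0 uB] /andP[v0 vB].
    rewrite /B in uB vB.
    have [uv|uv] := leP u v.
      by rewrite loc; [rewrite ler0_norm|..]; lra.
    by rewrite metric_sym loc; [rewrite gtr0_norm|..]; lra.
  pose rho := Num.min (Num.min A B) (e / 2).
  have rho0 : 0 < rho by rewrite !lt_min A0 B0 /=; lra.
  have rhoA : rho <= A by rewrite !ge_min lexx.
  have rhoB : rho <= B by rewrite !ge_min lexx orbT.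
  have rhoe : rho <= e / 2 by rewrite !ge_min lexx orbT.
  have rA : 0 <= rho / A <= 1.
    by rewrite divr_ge0 ?(ltW rho0) ?(ltW A0) //= ler_pdivrMr // mul1r.
  have rB : 0 <= rho / B <= 1.
    by rewrite divr_ge0 ?(ltW rho0) ?(ltW B0) //= ler_pdivrMr // mul1r.
  have := cat0_sq (s := rho / A) (t := rho / B) C g1 g2.
  rewrite dA dB !divfK ?gt_eqF // => /(_ rA rB).
  rewrite loc; [|lra|lra].
  set c := mdist _ _ => H.
  have c0 : 0 <= c by exact: mdist_ge0.
  have -> : r - s = A + B by rewrite /A /B; ring.
  apply/le_anti/andP; split.
    have := metric_triangle (g (a + s)) (g (a + t)) (g (a + r)).
    by rewrite (metric_sym (g (a + s)) (g (a + t))) dA dB.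
  rewrite -(@ler_pXn2r _ 2) ?nnegrE //; last by lra.
  rewrite -subr_ge0.
  have -> : c ^+ 2 - (A + B) ^+ 2 = (A * B / rho ^+ 2) *
    ((rho / A) ^+ 2 * A ^+ 2 + (rho / B) ^+ 2 * B ^+ 2 -
    rho / A * (rho / B) * (A ^+ 2 + B ^+ 2 - c ^+ 2) - (t + rho - (t - rho)) ^+ 2).
    by field; rewrite !gt_eqF.
  by rewrite mulr_ge0 ?subr_ge0 // !mulr_ge0 ?invr_ge0 ?exprn_ge0 // ltW.
Qed.

Lemma extend_line (i : interval R) (c : R -> X) : cat0 X -> geodesically_complete X ->
  geodesic_on i c -> exists2 g, geodesic_line g & forall t, t \in i -> g t = c t.
Proof.
move=> C GC /GC[g lg gc]; exists g => //; exact: local_geodesic_line.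
Qed.

Lemma line_through x y : cat0 X -> geodesically_complete X ->
  exists g, [/\ geodesic_line g, g 0 = x & g (mdist x y) = y].
Proof.
move=> C GC; have [c [gc c0 cy]] := C.1 x y.
have [g lg gE] := extend_line C GC gc.
by exists g; split=> //; rewrite gE // in_itv /= ?lexx ?mdist_ge0.
Qed.

Lemma line_ray (g : R -> X) t : geodesic_line g -> ray (fun s => g (t + s)).
Proof. by move=> lg s s' _ _; rewrite lg; congr `| _ |; ring. Qed.

Lemma line_back_ray (g : R -> X) t : geodesic_line g -> ray (fun s => g (t - s)).
Proof. by move=> lg s s' _ _; rewrite lg distrC; congr `| _ |; ring. Qed.

Lemma ray_dist (c : R -> X) s t : ray c -> 0 <= s <= t -> mdist (c s) (c t) = t - s.
Proof.
move=> rc /andP[s0 st]; rewrite rc ?in_itv /= ?andbT //; last exact: le_trans st.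
by rewrite ler0_norm ?opprB // subr_le0.
Qed.

Lemma ray_dist_bound (c : R -> X) x t : ray c -> 0 <= t ->
  `|mdist x (c t) - t| <= mdist x (c 0).
Proof.
move=> rc t0; have e : mdist (c 0) (c t) = t by rewrite ray_dist ?subr0 // lexx.
have := metric_triangle x (c 0) (c t); have := metric_triangle (c 0) x (c t).
rewrite (metric_sym (c 0) x) e ler_norml; lra.
Qed.

End lines.

(** * Busemann functions and asymptotic rays *)

Section rays.
Context {R : realType} (X : metricType R).
Implicit Types x y z : X.

Lemma proper_ball_compact x (M : R) : proper_space X ->
  compact [set y | mdist x y <= M].
Proof.
apply; last first.
  exists (2 * M) => y z /= xy xz.
  by have := metric_triangle y x z; rewrite (metric_sym y x); lra.
move=> y cy /=; apply/ler_addgt0Pr => e e0.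
have [z [/= xz]] := cy _ (nbhsx_ballx y e e0).
rewrite ballEmdist /= => yz.
apply: (le_trans (metric_triangle _ z _)); rewrite lerD //.
by rewrite metric_sym ltW.
Qed.

(** A Cauchy sequence is eventually in a compact ball and converges to its cluster
point. *)
Lemma proper_cauchy (u : nat -> X) : proper_space X ->
  (forall e : R, 0 < e -> exists N, forall m n, (N <= m <= n)%N -> mdist (u m) (u n) <= e) ->
  exists l, forall e : R, 0 < e -> exists N, forall n, (N <= n)%N -> mdist (u n) l <= e.
Proof.
move=> P cu.
have [N0 N0P] := cu 1 ltr01.
pose A := [set y | mdist (u N0) y <= 1].
have FA : (u @ \oo) A.
  by exists N0 => // n /= Nn; rewrite /A /=; apply: N0P; rewrite leqnn.
have [l [_ lcl]] := @proper_ball_compact (u N0) 1 P (u @ \oo) _ FA.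
exists l => e e0.
have e20 : 0 < e / 2 by lra.
have [N NP] := cu _ e20.
exists N => n Nn.
have F : (u @ \oo) [set u m | m in [set m | (n <= m)%N]].
  by exists n => // m /= nm; exists m.
have [z [[m /= nm <-]]] := lcl _ _ F (nbhsx_ballx l _ e20).
rewrite ballEmdist /= => lm.
have := NP n m; rewrite Nn nm => /(_ isT) nm'.
have := metric_triangle (u n) (u m) l; rewrite (metric_sym (u m) l); lra.
Qed.

(** The Busemann function of [c], defined as an infimum: [mdist x (c t) - t] is
nonincreasing in [t], so that this is also its limit at infinity. *)
Definition busemann (c : R -> X) x : R :=
  inf [set mdist x (c t) - t | t in [set t | 0 <= t]].

Lemma busemann_has_inf c x : ray c ->
  has_inf [set mdist x (c t) - t | t in [set t : R | 0 <= t]].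
Proof.
move=> rc; split; first by exists (mdist x (c 0) - 0), 0 => /=.
exists (- mdist x (c 0)) => _ [t /= t0 <-].
by have := ray_dist_bound x rc t0; rewrite ler_norml => /andP[].
Qed.

Lemma busemann_le c x t : ray c -> 0 <= t -> busemann c x <= mdist x (c t) - t.
Proof.
by move=> rc t0; apply: ge_inf; [exact: (busemann_has_inf x rc).2 | exists t].
Qed.

Lemma busemann_lip c x y : ray c -> busemann c x <= busemann c y + mdist x y.
Proof.
move=> rc; rewrite -lerBlDr; apply: lb_le_inf; first exact: (busemann_has_inf y rc).1.
move=> _ [t /= t0 <-].
have := busemann_le x rc t0; have := metric_triangle x y (c t); lra.
Qed.

Lemma busemann_approx c x e : ray c -> 0 < e ->
  exists2 T, 0 <= T & forall t, T <= t -> mdist x (c t) - t <= busemann c x + e.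
Proof.
move=> rc e0.
have [_ [T /= T0 <-] Tlt] := inf_adherent e0 (busemann_has_inf x rc).
exists T => // t Tt; apply: (le_trans _ (ltW Tlt)).
have := ray_dist rc (s := T) (t := t); rewrite T0 Tt => /(_ isT).
have := metric_triangle x (c T) (c t); lra.
Qed.

Lemma eps_eq (a b k : R) : (forall e, 0 < e -> `|a - b| <= k * e) -> a = b.
Proof.
move=> H; apply/eqP; rewrite -subr_eq0 -normr_le0; apply/ler_addgt0Pr => e e0.
rewrite add0r.
have k0 : 0 < `|k| + 1 by rewrite ltr_wpDl.
have := H (e / (`|k| + 1)); rewrite divr_gt0 // => /(_ isT) /le_trans; apply.
rewrite mulrA ler_pdivrMr // mulrC ler_pM2l //.
by have := ler_norm k; lra.
Qed.

(** The ray from [p] asymptotic to [c] is the limit of the segments [sg n] from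
[p] to [c n]. *)
Section construction.
Context (c : R -> X) (p : X) (rc : ray c) (C : cat0 X) (P : proper_space X).
Context (sg : nat -> R -> X).
Context (sgP : forall n, geodesic_segment p (c n%:R) (sg n)).
Let D := mdist p (c 0).
Let a n := mdist p (c n%:R).

Let D0 : 0 <= D. Proof. exact: mdist_ge0. Qed.

Let aD n : `|a n - n%:R| <= D.
Proof. exact: ray_dist_bound. Qed.

(** By the CAT(0) inequality the left-hand side is at most [m s^2 ((n - m)^2 -
(a n - a m)^2) / (a m * a n)]. Here [a n - n] is bounded by [D], so one factor of
the difference of squares is at most [2 D] and the other at most [2 n], while
[a m * a n] is at least [m n / 4]. *)
Lemma segment_cauchy s m n : 0 <= s -> (m <= n)%N ->
  1 <= m%:R :> R -> 2 * D <= m%:R -> s + D <= m%:R ->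
  m%:R * mdist (sg m s) (sg n s) ^+ 2 <= 16 * D * s ^+ 2.
Proof.
move=> s0 mn m1 mD ms.
have mn' : m%:R <= n%:R :> R by rewrite ler_nat.
have := aD m; have := aD n; rewrite !ler_norml => /andP[bn1 bn2] /andP[am1 am2].
have cc : mdist (c m%:R) (c n%:R) = n%:R - m%:R by rewrite ray_dist // ler0n.
have am0 : 0 < a m by lra.
have an0 : 0 < a n by lra.
have H1 : 0 <= s / a m <= 1 by rewrite divr_ge0 ?(ltW am0) //= ler_pdivrMr // mul1r; lra.
have H2 : 0 <= s / a n <= 1 by rewrite divr_ge0 ?(ltW an0) //= ler_pdivrMr // mul1r; lra.
have := cat0_sq C (sgP m) (sgP n) H1 H2.
rewrite -/(a m) -/(a n) !divfK ?gt_eqF // cc => H.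
have tr : `|a n - a m| <= n%:R - m%:R.
  have := metric_triangle p (c m%:R) (c n%:R).
  have := metric_triangle p (c n%:R) (c m%:R).
  by rewrite (metric_sym (c n%:R)) cc -/(a m) -/(a n) ler_norml; lra.
move: tr; rewrite ler_norml => /andP[tr1 tr2].
have m0 : 0 <= m%:R :> R by lra.
apply: (le_trans (ler_wpM2l m0 H)).
set M := m%:R in m0 m1 mD ms mn' am1 am2 cc H tr1 tr2 *.
set N := n%:R in mn' bn1 bn2 cc H tr1 tr2 *.
have -> : M * ((s / a m) ^+ 2 * a m ^+ 2 + (s / a n) ^+ 2 * a n ^+ 2 -
   s / a m * (s / a n) * (a m ^+ 2 + a n ^+ 2 - (N - M) ^+ 2)) =
   s ^+ 2 * (M * ((N - M) ^+ 2 - (a n - a m) ^+ 2) / (a m * a n)).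
  by field; rewrite !gt_eqF.
rewrite [leRHS]mulrC ler_wpM2l ?sqr_ge0 //.
rewrite ler_pdivrMr ?mulr_gt0 //.
have q1 : (N - M) ^+ 2 - (a n - a m) ^+ 2 <= 4 * D * N.
  have -> : (N - M) ^+ 2 - (a n - a m) ^+ 2 =
    (N - M - (a n - a m)) * (N - M + (a n - a m)) by ring.
  have -> : 4 * D * N = (2 * D) * (2 * N) by ring.
  by apply: ler_pM; lra.
have q2 : M * N <= 4 * (a m * a n).
  have -> : 4 * (a m * a n) = (2 * a m) * (2 * a n) by ring.
  by apply: ler_pM; lra.
apply: (le_trans (ler_wpM2l m0 q1)).
have -> : M * (4 * D * N) = (4 * D) * (M * N) by ring.
have -> : 16 * D * (a m * a n) = (4 * D) * (4 * (a m * a n)) by ring.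
by rewrite ler_wpM2l // mulr_ge0.
Qed.

(** Seen from [c n], the points [sg n (t / n * a n)] and [c t] divide the sides
to [p] and to [c 0] in the same ratio, so that their distance is at most [D];
and [t / n * a n] differs from [t] by at most [D]. *)
Lemma segment_near t n : 0 <= t -> 1 <= n%:R :> R -> 2 * D <= n%:R -> t + D <= n%:R ->
  mdist (c t) (sg n t) <= 2 * D.
Proof.
move=> t0 n1 nD nt.
have := aD n; rewrite ler_norml => /andP[bn1 bn2].
have an0 : 0 < a n by lra.
set N := n%:R in n1 nD nt bn1 bn2.
have [gs sg0 sgn] := sgP n.
have aE : mdist (c N) p = a n by rewrite metric_sym.
have nE : mdist (c N) (c 0) = N.
  by rewrite metric_sym ray_dist ?subr0 // lexx /=; lra.
have g1 : geodesic_segment (c N) p (fun u => sg n (a n - u)).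
  split; rewrite ?aE ?subr0 ?subrr //.
  move=> u v; rewrite !in_itv /= => /andP[u0 ua] /andP[v0 va].
  by rewrite gs ?in_itv /= -/(a n); [rewrite distrC; congr `|_|; ring|lra|lra].
have g2 : geodesic_segment (c N) (c 0) (fun u => c (N - u)).
  split; rewrite ?nE ?subr0 ?subrr //.
  move=> u v; rewrite !in_itv /= => /andP[u0 ua] /andP[v0 va].
  by rewrite rc ?in_itv /= ?andbT; [rewrite distrC; congr `|_|; ring|lra|lra].
have N0 : 0 < N by lra.
have l01 : 0 <= 1 - t / N <= 1.
  have : 0 <= t / N <= 1 by rewrite divr_ge0 ?(ltW N0) //= ler_pdivrMr // mul1r; lra.
  by move=> /andP[? ?]; lra.
have := cat0_sq C g1 g2 l01 l01; rewrite aE nE -/D.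
have -> : a n - (1 - t / N) * a n = t / N * a n by ring.
have -> : N - (1 - t / N) * N = t by field; rewrite gt_eqF.
set l := 1 - t / N in l01 *.
have -> : l ^+ 2 * a n ^+ 2 + l ^+ 2 * N ^+ 2 - l * l * (a n ^+ 2 + N ^+ 2 - D ^+ 2)
  = (l * D) ^+ 2 by ring.
move: l01 => /andP[l0 l1].
rewrite ler_pXn2r ?nnegrE ?mdist_ge0 ?mulr_ge0 // => H1.
have H2 : mdist (sg n (t / N * a n)) (sg n t) <= D.
  have tN : 0 <= t / N by rewrite divr_ge0 // ltW.
  have tN1 : t / N <= 1 by rewrite /l in l0; lra.
  rewrite gs ?in_itv /= -/(a n); last 2 first.
  - by rewrite mulr_ge0 ?(ltW an0) //= -[leRHS]mul1r ler_wpM2r // ltW.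
  - by lra.
  have -> : t / N * a n - t = t / N * (a n - N) by field; rewrite gt_eqF.
  rewrite normrM ger0_norm // -[leRHS]mul1r ler_pM //.
have lD : l * D <= D by rewrite -[leRHS]mul1r ler_wpM2r.
have := metric_triangle (c t) (sg n (t / N * a n)) (sg n t).
by rewrite (metric_sym (c t) (sg n (t / N * a n))); lra.
Qed.

Lemma segment_limit s : 0 <= s ->
  exists l, forall e : R, 0 < e -> exists N, forall n, (N <= n)%N -> mdist (sg n s) l <= e.
Proof.
move=> s0; apply: proper_cauchy => // e e0.
pose q := 16 * D * s ^+ 2 / e ^+ 2.
have q0 : 0 <= q.
  by rewrite divr_ge0 ?sqr_ge0 // !mulr_ge0 // sqr_ge0.
pose B := 1 + 2 * D + (s + D) + q.
have B0 : 0 <= B by rewrite /B; move: D0 q0 s0; lra.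
exists (Num.bound B) => m n /andP[Bm mn].
have Bm' : B <= m%:R.
  by rewrite (le_trans (ltW (archi_boundP B0))) // ler_nat.
have {}Bm' : 1 + 2 * D + (s + D) + q <= m%:R := Bm'.
have m1 : 1 <= m%:R :> R by move: D0 q0 s0 Bm'; lra.
have mD : 2 * D <= m%:R by move: D0 q0 s0 Bm'; lra.
have ms : s + D <= m%:R by move: D0 q0 s0 Bm'; lra.
have mq : q <= m%:R by move: D0 q0 s0 Bm'; lra.
have H := segment_cauchy s0 mn m1 mD ms.
rewrite -(@ler_pXn2r _ 2) ?nnegrE ?mdist_ge0 ?(ltW e0) //.
have m0 : 0 < m%:R :> R by lra.
rewrite -(ler_pM2l m0); apply: (le_trans H).
by rewrite -ler_pdivrMr ?exprn_gt0.
Qed.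

End construction.

(** The last clause says that the Busemann function decreases at unit speed on
[r]. It holds since, on the segment from [p] to [c n], the distance to [c n] does. *)
Lemma asymptotic_ray (c : R -> X) p : cat0 X -> proper_space X -> ray c ->
  exists r, [/\ ray r, r 0 = p, asymptotic c r &
    forall s, 0 <= s -> busemann c (r s) <= busemann c p - s].
Proof.
move=> C P rc.
have [sg sgP] := choice (fun n : nat => C.1 p (c n%:R)).
have lim s : exists l, 0 <= s -> forall e : R, 0 < e ->
    exists N, forall n, (N <= n)%N -> mdist (sg n s) l <= e.
  have [s0|s0] := leP 0 s; last by exists p.
  by have [l lP] := segment_limit rc C P sgP s0; exists l.
have [r rP] := choice lim.
pose D := mdist p (c 0).
have D0 : 0 <= D by exact: mdist_ge0.
have aD n : `|mdist p (c n%:R) - n%:R| <= D by exact: ray_dist_bound.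
have near2 s t (K e : R) : 0 <= s -> 0 <= t -> 0 < e -> exists n,
    [/\ K <= n%:R, mdist (sg n s) (r s) <= e & mdist (sg n t) (r t) <= e].
  move=> s0 t0 e0.
  have [N1 N1P] := rP s s0 e e0; have [N2 N2P] := rP t t0 e e0.
  pose N3 := Num.bound `|K|; exists (maxn (maxn N1 N2) N3); split.
  - rewrite (le_trans (ler_norm K)) // (le_trans (ltW (archi_boundP (normr_ge0 K)))) //.
    by rewrite ler_nat leq_maxr.
  - by apply: N1P; rewrite !leq_max leqnn.
  - by apply: N2P; rewrite !leq_max leqnn orbT.
have rr : ray r.
  move=> s t; rewrite !in_itv /= !andbT => s0 t0.
  apply: (@eps_eq _ _ 2) => e e0.
  have [n [nK ns nt]] := near2 s t (s + t + D) e s0 t0 e0.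
  have [gs _ _] := sgP n.
  have := aD n; rewrite ler_norml => /andP[a1 a2].
  have dn : mdist (sg n s) (sg n t) = `|s - t| by rewrite gs // in_itv /=; lra.
  rewrite ler_norml.
  have := metric_triangle (r s) (sg n s) (r t).
  have := metric_triangle (sg n s) (sg n t) (r t).
  have := metric_triangle (sg n s) (r s) (sg n t).
  have := metric_triangle (r s) (r t) (sg n t).
  rewrite dn (metric_sym (r t)) (metric_sym (r s) (sg n s)); lra.
exists r; split => //.
- apply: mdist_positivity; apply: (@eps_eq _ _ 1) => e e0.
  have [n [_ n0 _]] := near2 0 0 0 e (lexx _) (lexx _) e0.
  have [_ sg0 _] := sgP n.
  by rewrite subr0 ger0_norm ?mdist_ge0 // mul1r metric_sym -sg0.
- exists (2 * D) => t t0; apply/ler_addgt0Pr => e e0.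
  have [n [nK nt _]] := near2 t t (1 + 2 * D + (t + D)) e t0 t0 e0.
  have := @segment_near c p rc C sg sgP t n t0.
  rewrite -/D => /(_ ltac:(lra) ltac:(lra) ltac:(lra)).
  have := metric_triangle (c t) (sg n t) (r t); lra.
- move=> s s0; apply/ler_addgt0Pr => e e0.
  have e20 : 0 < e / 2 by lra.
  have [T T0 TP] := busemann_approx p rc e20.
  have [n [nK ns _]] := near2 s s (T + s + D) (e / 2) s0 s0 e20.
  have nT : T <= n%:R by lra.
  have n0 : 0 <= n%:R :> R by lra.
  have := TP _ nT.
  have := busemann_le (sg n s) rc n0.
  have := busemann_lip (r s) (sg n s) rc.
  have [gs _ sgn] := sgP n.
  have := aD n; rewrite ler_norml => /andP[a1 a2].
  have : mdist (sg n s) (c n%:R) = mdist p (c n%:R) - s.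
    rewrite -{1}sgn gs ?in_itv /=; [|lra|lra].
    by rewrite ler0_norm; lra.
  rewrite (metric_sym (r s)); lra.
Qed.

End rays.

(** * Length metrics, correspondences and arcs of the sphere *)

Section emetric.
Context {R : realType}.

(** A path is at least as long as the polygon with its ends as only vertices. *)
Lemma length_metric_ge (T : Type) (d : T -> T -> \bar R) x y :
  (d x y <= length_metric d x y)%E.
Proof.
apply: le_ereal_inf_tmp => _ [c [_ c0 c1] <-].
apply: ereal_sup_ubound; exists [:: 1].
  by split => //=; rewrite andbT ltr01.
by rewrite /polygonal_length /= big_nat1 /= c0 c1.
Qed.

(** Points are related when their images in a common extended metric space are
at distance less than some [r < delta]; the bound is the triangle inequality. *)
Lemma gromov_hausdorff_correspondence (S T : Type) (dS : S -> S -> \bar R)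
    (dT : T -> T -> \bar R) (delta : R) :
  (gromov_hausdorff dS dT < delta%:E)%E ->
  exists rel : S -> T -> Prop,
    [/\ forall x, exists u, rel x u, forall u, exists x, rel x u &
        forall x y u v, rel x u -> rel y v -> (dS x y <= dT u v + (2 * delta)%:E)%E].
Proof.
move=> /ereal_inf_lt[_ [Z [dZ [f [g [[_ _ sZ tZ] fE gE ->]]]]]].
move=> /ereal_inf_lt[_ [r [r0 fg gf] <-]]; rewrite lte_fin => rd.
exists (fun x u => (dZ (f x) (g u) < r%:E)%E); split.
- move=> x; have [|_ [u _ <-] xu] := fg (f x); first by exists x.
  by exists u.
- move=> u; have [|_ [x _ <-] xu] := gf (g u); first by exists u.
  by exists x.
- move=> x y u v xu yv.
  rewrite -fE -gE; apply: (le_trans (tZ _ (g u) _)).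
  have H := tZ (g u) (g v) (f y).
  apply: (le_trans (leeD (ltW xu) H)).
  rewrite (sZ (g v)); apply: (le_trans (leeD (lexx _) (leeD (lexx _) (ltW yv)))).
  rewrite addeCA; apply: leeD => //.
  by rewrite -EFinD lee_fin; lra.
Qed.

Lemma dotp_plane n (u w : euclidean R n) (a b a' b' : R) :
  dotp (a *: u + b *: w) (a' *: u + b' *: w) =
  a * a' * dotp u u + (a * b' + a' * b) * dotp u w + b * b' * dotp w w.
Proof.
rewrite /dotp !mulr_sumr -!big_split /=; apply: eq_bigr => i _.
by rewrite !mxE; ring.
Qed.

Lemma dotp_sphere n (u : sphere R n) : dotp (sval u) (sval u) = 1.
Proof.
by case: u => u /= u1; rewrite -[LHS]sqr_sqrtr ?dotp_ge0 // -/(enorm u) u1 expr1n.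
Qed.

Lemma dotp_sphere_itv n (u v : sphere R n) : -1 <= dotp (sval u) (sval v) <= 1.
Proof.
have := cauchy_schwarz (sval u) (sval v); rewrite !dotp_sphere mulr1.
by move=> H; apply/andP; split; nra.
Qed.

Lemma polygonal_length_isometric (T : Type) (d : T -> T -> \bar R) (c : R -> T) k s :
  (forall s t, 0 <= s -> s <= t -> t <= 1 -> d (c s) (c t) = (k * (t - s))%:E) ->
  itv_partition 0 1 s -> polygonal_length d c s = k%:E.
Proof.
move=> H [] ; rewrite /polygonal_length.
suff : forall a, 0 <= a -> path <%R a s -> last a s == 1 ->
  a <= 1 /\ (\sum_(0 <= k0 < size s) d ((c \o nth 1%R (a :: s)) k0)
      ((c \o nth 1%R (a :: s)) k0.+1))%E = (k * (1 - a))%:E.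
  by move=> /(_ 0 (lexx _)) K p l; have [_ ->] := K p l; rewrite subr0 mulr1.
elim: s => [|b s IH] a a0 /=.
  by move=> _ /eqP ->; rewrite big_geq // subrr mulr0.
move=> /andP[ab pb] l1.
have b0 : 0 <= b by lra.
have [b1 sE] := IH b b0 pb l1.
split; first by lra.
rewrite big_nat_recl //= H //; last by lra.
transitivity ((k * (b - a))%:E + (k * (1 - b))%:E)%E.
  by congr (_ + _)%E; exact: sE.
by rewrite -EFinD; congr EFin; ring.
Qed.

(** Arcs of great circles. Antipodal points are left out: they would need a
third point of the sphere, and for [n = 1] their distance is infinite. *)
Lemma sphere_metric_le n (u v : sphere R n) : -1 < dotp (sval u) (sval v) ->
  (sphere_metric u v <= (acos (dotp (sval u) (sval v)))%:E)%E.
Proof.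
move=> uv1; set a := dotp _ _ in uv1 *.
have /andP[_ a1] := dotp_sphere_itv u v; rewrite -/a in a1.
have aI : -1 <= a <= 1 by rewrite ltW.
set th := acos a.
suff [c [c0 c1 cd]] : exists c : R -> sphere R n, [/\ c 0 = u, c 1 = v &
    forall s t, 0 <= s -> s <= t -> t <= 1 ->
      acos (dotp (sval (c s)) (sval (c t))) = th * (t - s)].
  apply: ereal_inf_lbound => /=; exists c; last first.
    apply/eqP; rewrite eq_le; apply/andP; split.
      apply: ge_ereal_sup => _ [s hs <-].
      rewrite (@polygonal_length_isometric _ _ _ th) // => s' t' h1 h2 h3.
      by rewrite cd.
    apply: ereal_sup_ubound; exists [:: 1].
      by split => //=; rewrite andbT ltr01.
    by rewrite /polygonal_length /= big_nat1 /= c0 c1.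
  split => // t; rewrite in_itv /= => /andP[t0 t1] e e0.
  have th0 : 0 <= th by exact: acos_ge0.
  exists (e / (th + 1)); first by rewrite divr_gt0 // ltr_wpDl.
  move=> s; rewrite in_itv /= => /andP[s0 s1] ts; rewrite lte_fin.
  have -> : acos (dotp (sval (c t)) (sval (c s))) = th * `|t - s|.
    have [st|st] := leP s t.
      by rewrite ger0_norm ?subr_ge0 // -cd // /dotp; congr acos;
        apply: eq_bigr => i _; rewrite mulrC.
    by rewrite ltr0_norm ?subr_lt0 // opprB cd // ltW.
  move: ts; rewrite ltr_pdivlMr ?ltr_wpDl // => ts.
  apply: le_lt_trans ts; rewrite mulrC ler_wpM2l //; lra.
have [a1'|a1'] := eqVneq a 1.
  have uv : sval u = sval v.
    apply/eqP; rewrite -subr_eq0; apply/eqP/enorm_eq0.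
    have := dotp_lincomb (sval u) (sval v) 1 (- 1).
    rewrite !dotp_sphere -/a a1' scale1r scaleN1r /enorm => ->.
    by rewrite (_ : _ + _ = 0) ?sqrtr0 //; ring.
  exists (fun _ => u); split => //.
    by apply: eq_sig_hprop => // x p q; exact: Prop_irrelevance.
  by move=> s t _ _ _; rewrite dotp_sphere acos1 /th a1' acos1 mul0r.
have th0 : 0 < th by rewrite acos_gt0 // (ltW uv1) lt_neqAle a1'.
have thpi : th < pi by rewrite acos_ltpi // uv1.
have cth : cos th = a by rewrite acosK // in_itv.
have sth : 0 < sin th by rewrite sin_gt0_pi // th0.
have cs : cos th ^+ 2 + sin th ^+ 2 = 1 by rewrite cos2Dsin2.
pose w : euclidean R n := (sin th)^-1 *: (sval v - cos th *: sval u).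
have vE : sval v = cos th *: sval u + sin th *: w.
  by rewrite /w scalerA divff ?gt_eqF // scale1r addrC subrK.
have dl (b b' : R) (x y z : euclidean R n) : dotp x (b *: y + b' *: z) = b * dotp x y + b' * dotp x z.
  rewrite /dotp !mulr_sumr -big_split; apply: eq_bigr => i _.
  by rewrite !mxE /=; ring.
have uw : dotp (sval u) w = 0.
  have := erefl a; rewrite {1}/a vE dl dotp_sphere cth => H.
  have : sin th * dotp (sval u) w = 0 by lra.
  by move/eqP; rewrite mulf_eq0 gt_eqF //= => /eqP.
have ww : dotp w w = 1.
  have := dotp_sphere v; rewrite vE dotp_lincomb dotp_sphere uw.
  move=> H; have : sin th ^+ 2 * (dotp w w - 1) = 0 by lra.
  by move/eqP; rewrite mulf_eq0 expf_eq0 /= gt_eqF //= subr_eq0 => /eqP.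
pose cc (t : R) : euclidean R n := cos (t * th) *: sval u + sin (t * th) *: w.
have dcc s t : dotp (cc s) (cc t) = cos (t * th - s * th).
  by rewrite dotp_plane dotp_sphere uw ww cosB; ring.
have cc1 t : enorm (cc t) = 1 by rewrite /enorm dcc subrr cos0 sqrtr1.
have svP (x y : sphere R n) : sval x = sval y -> x = y.
  by move=> xy; apply: eq_sig_hprop => // z p q; exact: Prop_irrelevance.
exists (fun t => exist _ (cc t) (cc1 t)); split.
- by apply: svP; rewrite /= /cc mul0r cos0 sin0 scale1r scale0r addr0.
- by apply: svP; rewrite /= /cc mul1r -vE.
- move=> s t s0 st t1 /=; rewrite dcc -mulrBl cosK 1?mulrC //.
  rewrite in_itv /= mulr_ge0 ?subr_ge0 ?(ltW th0) //=.
  by apply: (le_trans _ (ltW thpi)); rewrite ler_piMr ?(ltW th0) //; lra.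
Qed.

End emetric.

(** * Angles and the first variation of Busemann functions *)

Section cosine.
Context {R : realType}.

Lemma cos_lip (x y : R) : x <= y -> cos x - cos y <= y - x.
Proof.
rewrite le_eqVlt => /orP[/eqP ->|xy]; first by rewrite !subrr.
have [|z _ zE] := @MVT R cos (fun z => - sin z) x y xy (fun z _ => is_derive_cos z).
  by apply: continuous_subspaceT => z; exact: continuous_cos.
have : cos x - cos y = sin z * (y - x) by rewrite -opprB zE; ring.
move=> ->; rewrite -[leRHS]mul1r ler_wpM2r ?subr_ge0 ?(ltW xy) ?sin_le1 //.
Qed.

(** The cosine is 1-Lipschitz, so an upper bound on an angle is, up to the same
error, a lower bound on its cosine. *)
Lemma acos_lt_shift (a k gamma : R) : -1 <= a <= 1 -> -1 <= k <= 1 -> 0 <= gamma ->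
  acos k < acos a + gamma -> a - gamma <= k.
Proof.
move=> aI kI g0 H.
have aE : cos (acos a) = a by rewrite acosK // in_itv.
have kE : cos (acos k) = k by rewrite acosK // in_itv.
have [ak|ka] := leP (acos a) (acos k).
  by have := cos_lip ak; rewrite aE kE; lra.
have : cos (acos a) < cos (acos k).
  by rewrite ltr_cos // in_itv /= acos_ge0 ?acos_lepi.
rewrite aE kE; lra.
Qed.

End cosine.

Section angle.
Context {R : realType} (X : metricType R).
Implicit Types x y z : X.

Lemma at_right0_small (A : set R) : (0 : R)^'+ A ->
  exists2 h : R, 0 < h & forall s, 0 < s < h -> A s.
Proof.
rewrite /at_right /within /= => /nbhs_ballP[h h0 hA].
exists h => // s /andP[s0 sh]; apply: hA => //.
by rewrite /ball /= sub0r normrN gtr0_norm.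
Qed.

Lemma geodesic_angle_lt (c r : R -> X) (theta : R) :
  ray c -> ray r -> (geodesic_angle c r < theta%:E)%E ->
  exists2 h : R, 0 < h & forall s t, 0 < s < h -> 0 < t < h ->
    comparison_angle s t (mdist (c s) (r t)) < theta.
Proof.
move=> rc rr /ereal_inf_lt[_ [V [[A B] /= [A0 B0] ABV] <-] Vth].
have [h1 h10 hA] := at_right0_small A0.
have [h2 h20 hB] := at_right0_small B0.
exists (Num.min h1 h2) => [|s t]; first by rewrite lt_min h10.
rewrite !lt_min => /andP[s0 /andP[sh1 _]] /andP[t0 /andP[_ th2]].
rewrite -lte_fin; apply: le_lt_trans Vth; apply: ereal_sup_ubound.
exists (s, t) => /=; first by apply: ABV; split; [apply: hA|apply: hB]; apply/andP.
by rewrite !ray_dist ?subr0 ?lexx ?ltW.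
Qed.

(** All comparison angles are those of a flat triangle. *)
Lemma line_angle (g : R -> X) (t : R) : geodesic_line g ->
  (pi%:E <= geodesic_angle (fun s => g (t + s)%R) (fun s => g (t - s)%R))%E.
Proof.
move=> lg; apply: le_ereal_inf_tmp => _ [V [[A B] /= [A0 B0] ABV] <-].
have [h1 h10 hA] := at_right0_small A0.
have [h2 h20 hB] := at_right0_small B0.
apply: ereal_sup_ubound; exists (h1 / 2, h2 / 2) => /=.
  by apply: ABV; split; [apply: hA|apply: hB] => /=; lra.
have h120 : 0 < h1 / 2 by lra.
have h220 : 0 < h2 / 2 by lra.
rewrite !lg /comparison_angle addr0 subr0.
have -> : t - (t + h1 / 2) = - (h1 / 2) by ring.
have -> : t - (t - h2 / 2) = h2 / 2 by ring.
have -> : t + h1 / 2 - (t - h2 / 2) = h1 / 2 + h2 / 2 by ring.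
rewrite normrN !gtr0_norm //; last by lra.
rewrite -acosN1; congr (acos _)%:E; field; lra.
Qed.

Lemma angle_le_metric (xi eta : ideal_boundary X) (c r : R -> X) :
  sval xi c -> sval eta r -> c 0 = r 0 -> (geodesic_angle c r <= angle_metric xi eta)%E.
Proof.
by move=> xc er cr; apply: ereal_sup_ubound; exists (c 0), c, r; split.
Qed.

Lemma ideal_ray (xi : ideal_boundary X) c : sval xi c -> ray c.
Proof. by case: xi => s /= [c' rc' ->] [rc _]. Qed.

Lemma ideal_asymptotic (xi : ideal_boundary X) c c' :
  sval xi c -> ray c' -> asymptotic c c' -> sval xi c'.
Proof.
case: xi => s /= [c0 rc0 ->] [rc [M HM]] rc' [M' HM']; split => //.
exists (M + M') => t t0.
exact: le_trans (metric_triangle _ (c t) _) (lerD (HM t t0) (HM' t t0)).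
Qed.

Lemma ideal_class (c : R -> X) : ray c -> exists xi : ideal_boundary X, sval xi c.
Proof.
move=> rc; pose A := [set c' | ray c' /\ asymptotic c c'].
have hA : exists2 c0, ray c0 & A = [set c' | ray c' /\ asymptotic c0 c'] by exists c.
exists (exist _ A hA); split => //.
by exists 0 => t _; rewrite mdistxx.
Qed.

Lemma ideal_nonempty (xi : ideal_boundary X) : exists c, sval xi c.
Proof.
by case: xi => s /= [c rc ->]; exists c; split => //; exists 0 => t _; rewrite mdistxx.
Qed.

Lemma ideal_shift (xi : ideal_boundary X) c t : 0 <= t ->
  sval xi c -> sval xi (fun s => c (t + s)).
Proof.
move=> t0 xc; have rc := ideal_ray xc.
apply: (ideal_asymptotic xc).
  move=> s s'; rewrite !in_itv /= !andbT => s0 s'0.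
  by rewrite rc ?in_itv /= ?andbT ?addr_ge0 //; congr `|_|; ring.
by exists t => s s0; rewrite ray_dist //; lra.
Qed.

(** The easy half of the first variation formula, in a form from which the
increment of a Busemann function can be bounded: by the law of cosines, [d =
mdist (c t) (r s)] satisfies [d^2 <= s^2 + t^2 - 2 s t k] with [k = a - gamma], so that
[d - s <= t^2 / (2 s) - t k]; the quadratic term is at most [t * eps] as soon as
[t <= 2 s eps]. *)
Lemma first_variation (c r : R -> X) (a gamma eps : R) :
  ray c -> ray r -> c 0 = r 0 -> -1 <= a <= 1 -> 0 <= gamma -> 0 < eps ->
  (geodesic_angle c r < (acos a + gamma)%:E)%E ->
  exists2 h : R, 0 < h & forall t, 0 < t < h ->
    exists2 s, 0 <= s & mdist (c t) (r s) - s <= - t * (a - gamma - eps).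
Proof.
move=> rc rr cr aI g0 e0 /(geodesic_angle_lt rc rr)[h h0 H].
have he0 : 0 < h * eps by rewrite mulr_gt0.
exists (Num.min h (h * eps)) => [|t]; first by rewrite lt_min h0.
rewrite lt_min => /andP[t0 /andP[th te]].
pose s := h / 2.
have s0 : 0 < s by rewrite /s; lra.
exists s; first exact: ltW.
have tI : 0 < t < h by rewrite t0.
have sI : 0 < s < h by rewrite s0 /s; lra.
have := H t s tI sI; rewrite /comparison_angle.
have ct : mdist (c 0) (c t) = t by rewrite ray_dist ?subr0 // lexx ltW.
have rs : mdist (c 0) (r s) = s by rewrite cr ray_dist ?subr0 // lexx ltW.
set d := mdist _ _.
have d1 : d <= t + s.
  by have := metric_triangle (c t) (c 0) (r s); rewrite (metric_sym (c t) (c 0)) ct rs.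
have d2 : s <= t + d.
  by have := metric_triangle (c 0) (c t) (r s); rewrite ct rs.
have d3 : t <= s + d.
  by have := metric_triangle (c 0) (r s) (c t); rewrite ct rs (metric_sym (r s)).
have st0 : 0 < 2 * t * s by rewrite !mulr_gt0.
(* the argument of [acos] must lie in its domain: triangle inequalities *)
move=> /(acos_lt_shift aI) -/(_ _ g0) K.
have {K} : a - gamma <= (t ^+ 2 + s ^+ 2 - d ^+ 2) / (2 * t * s).
  apply: K; rewrite ler_pdivlMr // ler_pdivrMr // mul1r mulN1r; apply/andP; split.
    have : 0 <= (t + s - d) * (t + s + d).
      by rewrite mulr_ge0 // ?subr_ge0 //; lra.
    by lra.
  have : 0 <= (d - t + s) * (d + t - s).
    by rewrite mulr_ge0 //; lra.
  by lra.
rewrite ler_pdivlMr // => K.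
have sq : 0 <= (d - s) ^+ 2 by exact: sqr_ge0.
have hs : h = 2 * s by rewrite /s; field.
rewrite -(ler_pM2l s0) -(ler_pM2l (ltr0n R 2)).
have tt : t * t <= t * (2 * s * eps) by rewrite ler_wpM2l ?(ltW t0) // -hs ltW.
nra.
Qed.

(** At each point of [c], the angle between [c] and the ray to [eta] is at most
the angle metric. Along the latter ray the Busemann function decreases at unit
speed, so [first_variation] bounds the upper right derivative of the Busemann
function along [c] by [- (a - gamma)]. *)
Lemma busemann_upper (xi eta : ideal_boundary X) (c e : R -> X) (a gamma : R) :
  cat0 X -> proper_space X -> sval xi c -> sval eta e ->
  -1 <= a <= 1 -> 0 <= gamma ->
  (angle_metric xi eta <= (acos a + gamma)%:E)%E ->
  forall t, 0 <= t -> busemann e (c t) - busemann e (c 0) <= - t * (a - gamma).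
Proof.
move=> C P xc ee aI g0 ang T T0.
have rc := ideal_ray xc; have re := ideal_ray ee.
suff H eps : 0 < eps -> forall t, 0 <= t ->
    busemann e (c t) - busemann e (c 0) <= - t * (a - gamma - eps).
  apply/ler_addgt0Pr => d d0.
  have T1 : 0 < T + 1 by lra.
  have := H (d / (T + 1)) (divr_gt0 d0 T1) T T0.
  have : T * (d / (T + 1)) <= d.
    rewrite mulrA ler_pdivrMr // mulrC ler_wpM2l ?(ltW d0) //; lra.
  lra.
move=> e0; apply: real_induction.
- by rewrite subrr oppr0 mul0r.
- move=> t t0 IH.
  set K := a - gamma - eps in IH *.
  apply/ler_addgt0Pr => d d0.
  have K1 : 0 < 1 + `|K| by rewrite ltr_pwDl.
  pose s := Num.max 0 (t - d / (1 + `|K|)).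
  have q0 : 0 < d / (1 + `|K|) by rewrite divr_gt0.
  have s0 : 0 <= s by rewrite le_max lexx.
  have st : s < t by rewrite gt_max t0 /=; lra.
  have sq : t - s <= d / (1 + `|K|).
    by rewrite lerBlDr -lerBlDl le_max lexx orbT.
  have sI : 0 <= s < t by rewrite s0.
  have := IH s sI.
  have := busemann_lip (c t) (c s) re.
  rewrite metric_sym ray_dist ?s0 ?(ltW st) //.
  have : (t - s) * (1 + K) <= d.
    apply: (@le_trans _ _ ((t - s) * (1 + `|K|))).
      by rewrite ler_wpM2l ?subr_ge0 ?(ltW st) // lerD2l ler_norm.
    by rewrite -ler_pdivlMr.
  lra.
- move=> t t0 IH.
  have [r [rr r0 ar rb]] := asymptotic_ray (c t) C P re.
  have er : sval eta r by exact: ideal_asymptotic ee rr ar.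
  have xt := ideal_shift t0 xc.
  have e20 : 0 < eps / 2 by lra.
  have cr : c (t + 0) = r 0 by rewrite addr0 r0.
  have ge0' : 0 <= gamma + eps / 2 by lra.
  have [|h h0 H] := @first_variation _ _ a (gamma + eps / 2) (eps / 2) (ideal_ray xt) rr cr aI ge0' e20.
    apply: (le_lt_trans (angle_le_metric xt er cr)).
    by apply: (le_lt_trans ang); rewrite lte_fin; lra.
  exists h => // s /andP[ts sh].
  have hI : 0 < s - t < h by lra.
  have [s' s'0] := H (s - t) hI.
  have tI : 0 <= t <= t by rewrite t0 lexx.
  rewrite subrKC.
  have := IH t tI.
  have := rb _ s'0.
  have := busemann_lip (c s) (r s') re.
  lra.
Qed.

End angle.

(** * Euclidean vectors *)

Section euclid.
Context {R : realType} {n : nat}.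

Lemma mdist_translate (a : euclidean R n) (u : sphere R n) t : 0 <= t ->
  mdist (a + t *: sval u) a = t.
Proof.
move=> t0; rewrite /mdist /= addrC addKr /enorm.
have := dotp_lincomb (sval u) 0 t 0; rewrite scale0r addr0 => ->.
by rewrite dotp_sphere mulr0 expr0n /= !mul0r !addr0 mulr1 sqrtr_sqr ger0_norm.
Qed.

Lemma sphere_direction (v w : euclidean R n) : v != w ->
  exists u : sphere R n, v = w + mdist v w *: sval u.
Proof.
rewrite -mdist_gt0 => d0; set d := mdist v w in d0 *.
have u1 : enorm (d^-1 *: (v - w)) = 1.
  rewrite /enorm; have := dotp_lincomb (v - w) 0 d^-1 0; rewrite scale0r addr0 => ->.
  rewrite mulr0 expr0n /= !mul0r !addr0.
  have -> : dotp (v - w) (v - w) = d ^+ 2 by rewrite [RHS]sqr_sqrtr // dotp_ge0.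
  by rewrite -exprMn mulVf ?gt_eqF // expr1n sqrtr1.
exists (exist (fun u : euclidean R n => enorm u = 1) _ u1) => /=.
by rewrite scalerA divff ?gt_eqF // scale1r addrC subrK.
Qed.

Lemma mdist_coord (a b : euclidean R n) (e : R) : 0 <= e ->
  (forall i, `|a 0 i - b 0 i| <= e) -> mdist a b <= Num.sqrt n%:R * e.
Proof.
move=> e0 H; rewrite -(@ler_pXn2r _ 2) ?nnegrE ?mdist_ge0 ?mulr_ge0 ?sqrtr_ge0 //.
rewrite exprMn !sqr_sqrtr ?dotp_ge0 ?ler0n //.
apply: (@le_trans _ _ (\sum_(i < n) e ^+ 2)); last first.
  by rewrite sumr_const card_ord mulr_natl.
rewrite /dotp; apply: ler_sum => i _; rewrite !mxE -expr2.
by rewrite -real_normK ?num_real // ler_pXn2r ?nnegrE.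
Qed.

Lemma enorm_delta (i : 'I_n) : enorm (delta_mx 0 i : 'rV[R]_n) = 1.
Proof.
rewrite /enorm /dotp (bigD1 i) //= big1 => [|j ji].
  by rewrite !mxE !eqxx mulr1 addr0 sqrtr1.
by rewrite !mxE (negbTE ji) andbF mulr0.
Qed.

Definition axis (i : 'I_n) : sphere R n :=
  exist (fun u : euclidean R n => enorm u = 1) _ (enorm_delta i).

Lemma dotp_axis (u : euclidean R n) i : dotp u (sval (axis i)) = u 0 i.
Proof.
rewrite /dotp /= (bigD1 i) //= big1.
  by rewrite !mxE !eqxx mulr1 addr0.
by move=> j ji; rewrite !mxE (negbTE ji) andbF mulr0.
Qed.

End euclid.

Lemma lipschitz_continuous (R : realType) (X Y : metricType R) (f : X -> Y) (K : R) :
  0 < K -> (forall x y, mdist (f x) (f y) <= K * mdist x y) -> continuous f.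
Proof.
move=> K0 H x; apply/cvg_ballP => e e0.
apply: filterS (nbhsx_ballx x (e / K) (divr_gt0 e0 K0)) => y.
rewrite !ballEmdist /= ltr_pdivlMr // mulrC => xy.
exact: le_lt_trans (H x y) xy.
Qed.

(** * The Busemann map *)

Section coordinates.
Context {R : realType} (n : nat) (X : metricType R).
Context (C : cat0 X) (P : proper_space X) (GC : geodesically_complete X).
Context (eta : R) (eta0 : 0 < eta).
Context (rel : ideal_boundary X -> sphere R n -> Prop).
Context (rel_total : forall xi, exists u, rel xi u).
Context (rel_onto : forall u, exists xi, rel xi u).
Context (rel_dist : forall xi zeta u v, rel xi u -> rel zeta v ->
  (tits_metric xi zeta <= sphere_metric u v + (2 * eta ^+ 2)%:E)%E).

Let eps := 2 * eta + 2 * eta ^+ 2.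

Let eta20 : 0 <= 2 * eta ^+ 2.
Proof. by rewrite mulr_ge0 ?sqr_ge0. Qed.

Lemma rel_angle xi zeta u v : rel xi u -> rel zeta v ->
  -1 < dotp (sval u) (sval v) ->
  (angle_metric xi zeta <= (acos (dotp (sval u) (sval v)) + 2 * eta ^+ 2)%:E)%E.
Proof.
move=> xu zv uv; apply: (le_trans (length_metric_ge _ _ _)).
apply: (le_trans (rel_dist xu zv)); rewrite EFinD leeD2r //.
exact: sphere_metric_le.
Qed.

(** For antipodal [u] and [v] the angle carries no information, but the claim
then follows from the Busemann function being 1-Lipschitz. *)
Lemma rel_upper xi zeta u v (c e : R -> X) : rel xi u -> rel zeta v ->
  sval xi c -> sval zeta e -> forall t, 0 <= t ->
  busemann e (c t) - busemann e (c 0) <= - t * (dotp (sval u) (sval v) - 2 * eta ^+ 2).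
Proof.
move=> xu zv xc ze t t0.
have /andP[uv1 uv2] := dotp_sphere_itv u v.
move: (uv1); rewrite le_eqVlt => /orP[/eqP uvN|uv]; last first.
  by apply: (busemann_upper C P xc ze) => //; [rewrite uv1|exact: rel_angle].
have := busemann_lip (c t) (c 0) (ideal_ray ze).
rewrite metric_sym (ray_dist (ideal_ray xc)) ?lexx // -uvN.
have : 0 <= t * (2 * eta ^+ 2) by rewrite mulr_ge0.
lra.
Qed.

(** The ends of a line are at angle pi, hence at Tits distance at least pi. *)
Lemma rel_opposite (g : R -> X) t xi zeta u z : geodesic_line g ->
  sval xi (fun s => g (t + s)) -> sval zeta (fun s => g (t - s)) ->
  rel xi u -> rel zeta z -> dotp (sval u) (sval z) <= -1 + 2 * eta ^+ 2.
Proof.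
move=> lg xg zg xu zz.
have /andP[uz1 uz2] := dotp_sphere_itv u z.
move: (uz1); rewrite le_eqVlt => /orP[/eqP <-|uz]; first by rewrite lerDl.
have E : g (t + 0) = g (t - 0) by rewrite addr0 subr0.
have := le_trans (line_angle t lg) (le_trans (angle_le_metric xg zg E) (rel_angle xu zz uz)).
rewrite lee_fin => H; apply/ler_addgt0Pr => d d0.
have gd0 : 0 <= 2 * eta ^+ 2 + d by rewrite addr_ge0 // ltW.
have uzI : -1 <= dotp (sval u) (sval z) <= 1 by rewrite uz1.
have NI : -1 <= (-1 : R) <= 1 by rewrite lexx /=; lra.
have := acos_lt_shift uzI NI gd0; rewrite acosN1.
have -> : pi < acos (dotp (sval u) (sval z)) + (2 * eta ^+ 2 + d) by lra.
by move=> /(_ isT); lra.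
Qed.

(** Extend [c] to a line and go from [c t] back to [c 0], which is moving towards
the other end of the line. Its related vector [z] is almost opposite to [u]:
[|u + z|^2 = 2 + 2 <u, z> <= 4 eta^2], so that [- <z, v>] exceeds [<u, v>] by at most
[2 eta], by the Cauchy-Schwarz inequality. *)
Lemma rel_lower xi zeta u v (c e : R -> X) : rel xi u -> rel zeta v ->
  sval xi c -> sval zeta e -> forall t, 0 <= t ->
  - t * (dotp (sval u) (sval v) + eps) <= busemann e (c t) - busemann e (c 0).
Proof.
move=> xu zv xc ze t t0.
have [g lg gc] := extend_line C GC (ideal_ray xc).
have xg : sval xi (fun s => g (t + s)).
  apply: (ideal_asymptotic (ideal_shift t0 xc)); first exact: line_ray.
  by exists 0 => s s0; rewrite gc ?mdistxx // in_itv /= andbT addr_ge0.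
have [om og] := ideal_class (line_back_ray t lg).
have [z oz] := rel_total om.
have uz := rel_opposite lg xg og xu oz.
have := rel_upper oz zv og ze t0.
rewrite subrr subr0 !gc ?in_itv /= ?lexx ?andbT // => H.
suff : - (2 * eta) <= dotp (sval u) (sval v) + dotp (sval z) (sval v).
  move=> /(ler_wpM2l t0); rewrite /eps; lra.
have dl : dotp (1 *: sval u + 1 *: sval z) (sval v) =
    dotp (sval u) (sval v) + dotp (sval z) (sval v).
  by rewrite /dotp -big_split; apply: eq_bigr => i _; rewrite !mxE /=; ring.
have := cauchy_schwarz (1 *: sval u + 1 *: sval z) (sval v).
rewrite dl dotp_sphere dotp_lincomb !dotp_sphere => CS.
set q := _ + _ in CS *.
have {}CS : q ^+ 2 <= (2 * eta) ^+ 2 by apply: (le_trans CS); lra.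
have : `|q| <= 2 * eta.
  rewrite -(@ler_pXn2r _ 2) ?nnegrE ?normr_ge0 //; first by rewrite real_normK ?num_real.
  by rewrite mulr_ge0 ?ltW.
by rewrite ler_norml => /andP[].
Qed.

Context (chart : 'I_n -> R -> X) (pole : 'I_n -> ideal_boundary X).
Context (chart_pole : forall i, sval (pole i) (chart i)).
Context (rel_pole : forall i, rel (pole i) (axis i)).
Context (eta_small : Num.sqrt n%:R * eps <= 1 / 2).

(** The sign makes the map increase along the ray [chart i] in the direction of
the [i]-th axis. *)
Definition busemann_map (x : X) : euclidean R n :=
  \row_i (- busemann (chart i) x).

Lemma busemann_map_ray xi u (c : R -> X) t : rel xi u -> sval xi c -> 0 <= t ->
  mdist (busemann_map (c t)) (busemann_map (c 0) + t *: sval u) <= t / 2.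
Proof.
move=> xu xc t0.
have eps0 : 0 <= eps by rewrite addr_ge0 // mulr_ge0 ?ltW.
apply: (@le_trans _ _ (Num.sqrt n%:R * (t * eps))); last first.
  by rewrite mulrCA; have := ler_wpM2l t0 eta_small; lra.
apply: mdist_coord => [|i]; first exact: mulr_ge0.
rewrite !mxE.
have := rel_upper xu (rel_pole i) xc (chart_pole i) t0.
have := rel_lower xu (rel_pole i) xc (chart_pole i) t0.
rewrite !dotp_axis ler_norml.
have : t * (2 * eta ^+ 2) <= t * eps.
  by rewrite ler_wpM2l // /eps lerDr mulr_ge0 ?ltW.
lra.
Qed.

Lemma busemann_map_dist x y :
  mdist x y / 2 <= mdist (busemann_map x) (busemann_map y) <= 3 / 2 * mdist x y.
Proof.
have [g [lg gx gy]] := line_through x y C GC.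
have d0 : 0 <= mdist x y by exact: mdist_ge0.
suff : mdist x y / 2 <= mdist (busemann_map (g 0)) (busemann_map (g (mdist x y)))
    <= 3 / 2 * mdist x y by rewrite gx gy.
move: (mdist x y) d0 => {gx gy} t d0.
have [xi xg] : exists xi : ideal_boundary X, sval xi g.
  by apply: ideal_class => s s' _ _; exact: lg.
have [u xu] := rel_total xi.
have := busemann_map_ray xu xg d0.
have := mdist_translate (busemann_map (g 0)) u d0.
set A := busemann_map _; set B := busemann_map _; set T := A + _.
have := metric_triangle A T B; have := metric_triangle A B T.
have := metric_triangle B A T; have := metric_triangle T B A.
rewrite (metric_sym A T) (metric_sym T B) (metric_sym A B); lra.
Qed.

(** A point [x] whose image is closest to [v] exists, since the map is Lipschitz
and expands distances by at least 1/2. If its image were not [v], moving from [x]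
towards an ideal point related to the direction of [v] would halve the
distance. *)
Lemma busemann_map_onto (x0 : X) (v : euclidean R n) : exists x, busemann_map x = v.
Proof.
pose f x := mdist v (busemann_map x).
have fl x y : `|f x - f y| <= 2 * mdist x y.
  have /andP[_ H] := busemann_map_dist x y.
  have := mdist_ge0 x y.
  have := metric_triangle v (busemann_map x) (busemann_map y).
  have := metric_triangle v (busemann_map y) (busemann_map x).
  rewrite (metric_sym (busemann_map y)) -/(f x) -/(f y) ler_norml; lra.
have fc : continuous f.
  move=> x; apply/cvg_ballP => e e0.
  have e20 : 0 < e / 2 by lra.
  apply: filterS (nbhsx_ballx x (e / 2) e20) => y.
  rewrite ballEmdist /= /ball /= => xy.
  by apply: (le_lt_trans (fl x y)); lra.
have f0 : 0 <= f x0 by exact: mdist_ge0.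
(* outside of this ball, [f x >= mdist x0 x / 2 - f x0 > f x0] *)
pose A := [set x | mdist x0 x <= 4 * f x0].
have A0 : A x0 by rewrite /A /= mdistxx mulr_ge0.
have cA : compact A := @proper_ball_compact _ _ x0 (4 * f x0) P.
have [x _ xmin] := compact_EVT_min (ex_intro _ x0 A0) cA (continuous_subspaceT fc).
have {}xmin y : f x <= f y.
  have [Ay|Ay] := leP (mdist x0 y) (4 * f x0); first by apply: xmin; apply/mem_set.
  have fx0 : f x <= f x0 by apply: xmin; apply/mem_set.
  apply: (le_trans fx0).
  have /andP[H _] := busemann_map_dist x0 y.
  have := metric_triangle (busemann_map x0) v (busemann_map y).
  rewrite (metric_sym (busemann_map x0) v) -/(f x0) -/(f y); lra.
exists x; apply/esym/eqP; apply/negPn/negP => vx.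
have [u vE] := sphere_direction vx.
have fx0 : 0 < f x by rewrite /f mdist_gt0.
have [xi xu] := rel_onto u.
have [c xc] := ideal_nonempty xi.
have [r [rr r0 ar _]] := asymptotic_ray x C P (ideal_ray xc).
have := busemann_map_ray xu (ideal_asymptotic xc rr ar) (ltW fx0).
rewrite r0 -vE metric_sym -/(f _).
have := xmin (r (f x)); lra.
Qed.

End coordinates.

Theorem theorem5p11 (R : realType) (n : nat) (n_gt0 : (0 < n)%N) :
  exists delta : R, 0 < delta /\
    forall X : metricType R,
      proper_space X -> geodesically_complete X -> cat0 X ->
      (gromov_hausdorff (@tits_metric R X) (@sphere_metric R n)
         < delta%:E)%E ->
      bilipschitz_homeomorphic (2 * Num.sqrt n%:R) X (euclidean R n).
Proof.
pose s : R := Num.sqrt n%:R.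
have s1 : 1 <= s by rewrite -sqrtr1 ler_sqrt ?ler0n // ler1n.
have s0 : 0 < s by lra.
(* [rel_lower] has the error [2 eta + 2 eta^2] in each of the [n] coordinates,
   hence [s * (2 eta + 2 eta^2) <= 1/2] in norm; [eta] is the square root of
   [delta]. *)
pose eta : R := (8 * s)^-1.
have eta0 : 0 < eta by rewrite invr_gt0; lra.
have seta : s * eta = 8^-1 by rewrite /eta; field; lra.
exists (eta ^+ 2); split; first by rewrite exprn_gt0.
move=> X P GC C /gromov_hausdorff_correspondence[rel [rt ro rd]].
have small : Num.sqrt n%:R * (2 * eta + 2 * eta ^+ 2) <= 1 / 2.
  rewrite -/s; have : s * eta ^+ 2 <= 8^-1.
    rewrite expr2 mulrA seta ler_piMr ?invr_ge0 // invf_le1; lra.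
  lra.
have [pole rp] := choice (fun i : 'I_n => ro (axis i)).
have [chart cp] := choice (fun i : 'I_n => ideal_nonempty (pole i)).
pose F := busemann_map chart.
have Fd x y : mdist x y / 2 <= mdist (F x) (F y) <= 3 / 2 * mdist x y.
  exact: (busemann_map_dist C P GC eta0 rt rd cp rp small).
have x0 : X := chart (Ordinal n_gt0) 0.
have [G FG] := choice (busemann_map_onto C P GC eta0 rt ro rd cp rp small x0).
rewrite -/F in FG.
have GF : cancel F G.
  move=> x; apply: mdist_positivity; apply: le_anti; rewrite mdist_ge0 andbT.
  by have /andP[] := Fd (G (F x)) x; rewrite FG mdistxx; lra.
exists F; split; last first.
  move=> x y; have /andP[H1 H2] := Fd x y; rewrite -/s.
  have := mdist_ge0 x y; have := mdist_ge0 (F x) (F y) => f0 d0.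
  have := ler_wpM2r d0 s1; have := ler_wpM2r f0 s1; lra.
split.
  by apply: (@lipschitz_continuous _ _ _ _ (3 / 2)) => [|x y]; [lra|have /andP[] := Fd x y].
exists G; split => //.
apply: (@lipschitz_continuous _ _ _ _ 2) => // a b.
by have /andP[] := Fd (G a) (G b); rewrite !FG; lra.
Qed.
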